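(* Let $t,u$ be terms, $k\in\mathbb{N}$, and $\vec{x}=(x_1,\dots,x_k)$ a list of pairwise distinct variables containing all free variables of $t$ and of $u$. If $t\simeq_{\mathsf{sh}}u$ then $[\![t]\!]_{\vec{x}}=[\![u]\!]_{\vec{x}}$.
   Context: Terms: $t ::= x \mid \lambda x.t \mid tu$ up to $\alpha$-conversion; values are variables and abstractions. Contexts $C ::= [\cdot]\mid\lambda x.C\mid Ct\mid tC$. Root rules: $(\lambda x.t)v \mapsto_{\beta_v} t\{v/x\}$ ($v$ value); $(\lambda x.t)us \mapsto_{\sigma_1} (\lambda x.ts)u$ if $x\notin\mathrm{fv}(s)$; $v((\lambda x.s)u) \mapsto_{\sigma_3} (\lambda x.vs)u$ if $v$ value and $x\notin\mathrm{fv}(v)$. $\to_{\mathsf{sh}}$ is the closure of the union of these rules under all contexts, and $\simeq_{\mathsf{sh}}$ its reflexive, symmetric, transitive closure. Types: negative $N ::= P\multimap Q$; positive $P,Q ::= [N_1,\dots,N_n]$ finite multisets ($n\ge0$), $\mathbf{0}$ the empty multiset. Environments: maps from variables to positive types, $\mathbf{0}$ almost everywhere; $\uplus$ pointwise multiset sum. Rules: (ax) $x\colon P\vdash x\colon P$; (@) from $\Gamma\vdash t\colon[P\multimap Q]$ and $\Gamma'\vdash u\colon P$ infer $\Gamma\uplus\Gamma'\vdash tu\colon Q$; ($\lambda$) for $n\ge0$, from $\Gamma_i,x\colon P_i\vdash t\colon Q_i$ ($1\le i\le n$) infer $\biguplus_i\Gamma_i\vdash\lambda x.t\colon[P_1\multimap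 Q_1,\dots,P_n\multimap Q_n]$. Semantics: $[\![t]\!]_{\vec{x}} = \{((P_1,\dots,P_k),Q) \mid \text{there is a derivation of } x_1\colon P_1,\dots,x_k\colon P_k \vdash t \colon Q\}$. *)

(* Defs.v *)
From HB Require Import structures.
From mathcomp Require Import all_boot finmap multiset classical_sets.
From Stdlib Require List.
From Stdlib Require Import Relation_Operators.

Set Implicit Arguments.
Unset Strict Implicit.
Unset Printing Implicit Defensive.

(* Terms up to alpha-conversion, as de Bruijn terms. An index that points past
   all the enclosing abstractions by n is a free occurrence of the variable
   named n; the (countably many) variables are thus the natural numbers. *)

Inductive term : Type :=
| Var of nat
| Lam of term
| App of term & term.

Definition is_value (t : term) : bool := if t is App _ _ then false else true.

Fixpoint fv (t : term) : seq nat :=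
  match t with
  | Var x => [:: x]
  | Lam t => [seq x.-1 | x <- fv t & x != 0]
  | App t u => fv t ++ fv u
  end.

Definition up_ren (f : nat -> nat) (n : nat) : nat :=
  if n is m.+1 then (f m).+1 else 0.

Fixpoint rename (f : nat -> nat) (t : term) : term :=
  match t with
  | Var x => Var (f x)
  | Lam t => Lam (rename (up_ren f) t)
  | App t u => App (rename f t) (rename f u)
  end.

(* [lift t] is [t] placed under one more binder, whose variable does not occur
   in it. *)
Definition lift (t : term) : term := rename succn t.

Definition up_subst (s : nat -> term) (n : nat) : term :=
  if n is m.+1 then lift (s m) else Var 0.

Fixpoint subst (s : nat -> term) (t : term) : term :=
  match t with
  | Var x => s x
  | Lam t => Lam (subst (up_subst s) t)
  | App t u => App (subst s t) (subst s u)
  end.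

(* [subst0 v t] is t{v/x}, where x is the variable bound by [Lam t]. *)
Definition subst0 (v t : term) : term :=
  subst (fun n => if n is m.+1 then Var m else v) t.

Inductive ctx : Type :=
| Hole
| CLam of ctx
| CAppL of ctx & term
| CAppR of term & ctx.

(* Filling a hole captures variables, so [t] is not lifted under [CLam]. *)
Fixpoint fill (C : ctx) (t : term) : term :=
  match C with
  | Hole => t
  | CLam C => Lam (fill C t)
  | CAppL C u => App (fill C t) u
  | CAppR u C => App u (fill C t)
  end.

(* The side conditions x \notin fv(s) of sigma_1 and x \notin fv(v) of sigma_3
   appear as the lifting of the term that enters the scope of the binder. *)
Inductive sh_root : term -> term -> Prop :=
| root_beta t v : is_value v -> sh_root (App (Lam t) v) (subst0 v t)
| root_sigma1 t u s :
    sh_root (App (App (Lam t) u) s) (App (Lam (App t (lift s))) u)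
| root_sigma3 v s u : is_value v ->
    sh_root (App v (App (Lam s) u)) (App (Lam (App (lift v) s)) u).

Definition sh_step (t u : term) : Prop :=
  exists C r r', [/\ sh_root r r', t = fill C r & u = fill C r'].

Definition sh_equiv : term -> term -> Prop := clos_refl_sym_trans term sh_step.

(* The negative types have to form the initial algebra of
   X |-> {mset X} * {mset X}. They are built as trees whose lists of children
   are sorted for a fixed total order, one such tree per class of trees modulo
   permutation of children at all levels; this encoding is only relevant up to
   [lolli_inj] and [neg_ind] below, which characterize the result. *)

Inductive raw : Type := Raw of seq raw & seq raw.

Fixpoint raw_nested_ind (K : raw -> Prop)
    (h : forall l r, (forall x, List.In x l -> K x) ->
                     (forall x, List.In x r -> K x) -> K (Raw l r))
    (a : raw) : K a :=
  let fix all_K (l : seq raw) : forall x, List.In x l -> K x :=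
    match l with
    | [::] => fun x (f : False) => match f with end
    | y :: l => fun x i =>
        match i with
        | or_introl e => let: erefl := e in raw_nested_ind h y
        | or_intror i => all_K l x i
        end
    end in
  let: Raw l r := a in h l r (all_K l) (all_K r).

Fixpoint raw_encode (a : raw) : GenTree.tree unit :=
  let: Raw l r := a in
  GenTree.Node 0 [:: GenTree.Node 0 (map raw_encode l);
                     GenTree.Node 0 (map raw_encode r)].

Fixpoint raw_decode (b : GenTree.tree unit) : option raw :=
  match b with
  | GenTree.Node _ [:: GenTree.Node _ l; GenTree.Node _ r] =>
      Some (Raw (pmap raw_decode l) (pmap raw_decode r))
  | _ => None
  end.

Lemma raw_encodeK : pcancel raw_encode raw_decode.
Proof.
have K (l : seq raw) :
    (forall x, List.In x l -> raw_decode (raw_encode x) = Some x) ->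
    pmap raw_decode (map raw_encode l) = l.
  elim: l => [//|x l IHl] H /=; rewrite H /=; last by left.
  by rewrite IHl // => y ly; apply: H; right.
by elim/raw_nested_ind => l r Hl Hr /=; rewrite !K.
Qed.

HB.instance Definition _ := Countable.copy raw (pcan_type raw_encodeK).

Definition raw_le : rel raw := relpre choice.pickle leq.

Lemma raw_le_total : total raw_le.
Proof. by move=> x y; apply: leq_total. Qed.

Lemma raw_le_trans : transitive raw_le.
Proof. by move=> y x z; apply: leq_trans. Qed.

Lemma raw_le_anti : antisymmetric raw_le.
Proof.
by move=> x y; rewrite /raw_le /= -eqn_leq => /eqP /(pcan_inj choice.pickleK).
Qed.

Fixpoint canonical (a : raw) : bool :=
  let: Raw l r := a in
  [&& sorted raw_le l, sorted raw_le r, all canonical l & all canonical r].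

Record neg : Type := Neg { raw_of_neg : raw; _ : canonical raw_of_neg }.
HB.instance Definition _ := [isSub for raw_of_neg].
HB.instance Definition _ := [Countable of neg by <:].

Declare Scope ty_scope.
Delimit Scope ty_scope with ty.
Local Open Scope mset_scope.
Local Open Scope ty_scope.

Notation pos := {mset neg}.

Definition raw_seq (P : pos) : seq raw := sort raw_le [seq val N | N <- P].

Lemma raw_seq_sorted (P : pos) : sorted raw_le (raw_seq P).
Proof. exact/sort_sorted/raw_le_total. Qed.

Lemma raw_seq_canonical (P : pos) : all canonical (raw_seq P).
Proof. by rewrite all_sort all_map; apply/allP => N _; apply: valP. Qed.

Lemma raw_seq_inj : injective raw_seq.
Proof.
move=> P Q /eqP; rewrite -(rwP eqP).
move/(perm_sortP raw_le_total raw_le_trans raw_le_anti)/(perm_map_inj val_inj).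
by move/eq_seq_msetP; rewrite !seq_mset_id.
Qed.

Lemma raw_seq_surj (l : seq raw) : sorted raw_le l -> all canonical l ->
  exists P, raw_seq P = l.
Proof.
move=> sl cl; exists (seq_mset (pmap insub l)).
apply: (sorted_eq raw_le_trans raw_le_anti) => //; first exact: raw_seq_sorted.
have el : map val (pmap (@insub _ canonical neg) l) = l.
  rewrite (pmap_filter (@insubK _ _ _)); apply/all_filterP.
  by apply: sub_all cl => x cx; rewrite /= insubT.
rewrite /raw_seq perm_sort -{2}el.
exact/perm_map/perm_eq_seq_mset.
Qed.

Lemma lolli_subproof (P Q : pos) : canonical (Raw (raw_seq P) (raw_seq Q)).
Proof. by rewrite /= !raw_seq_sorted !raw_seq_canonical. Qed.

Definition lolli (P Q : pos) : neg := Neg (lolli_subproof P Q).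
Notation "P ⊸ Q" := (lolli P Q) (at level 60, right associativity) : ty_scope.

Lemma lolli_inj (P P' Q Q' : pos) : P ⊸ Q = P' ⊸ Q' -> P = P' /\ Q = Q'.
Proof. by move/(congr1 val) => /= [] /raw_seq_inj-> /raw_seq_inj->. Qed.

Lemma neg_ind (K : neg -> Prop) :
  (forall P Q : pos, (forall N, N \in P -> K N) -> (forall N, N \in Q -> K N) ->
     K (P ⊸ Q)) ->
  forall N, K N.
Proof.
move=> H [a ca]; elim/raw_nested_ind: a ca => l r Hl Hr ca.
have /and4P[sl sr cl cr] := ca.
have [P eP] := raw_seq_surj sl cl; have [Q eQ] := raw_seq_surj sr cr.
have -> : Neg ca = P ⊸ Q by apply: val_inj; rewrite /= eP eQ.
have mem_raw (S : pos) N : N \in S -> List.In (val N) (raw_seq S).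
  move=> NS; have : val N \in raw_seq S by rewrite mem_sort map_f.
  elim: (raw_seq S) => [//|x s IHs]; rewrite inE => /orP[/eqP<-|/IHs]; first by left.
  by right.
apply: H => -[b cb] /mem_raw /=; rewrite ?eP ?eQ => ?; [exact: Hl|exact: Hr].
Qed.

Definition env : Type := {fsfun nat -> pos with mset0}.

Definition env0 : env := [fsfun].

Definition env1 (x : nat) (P : pos) : env := [fsfun y in [fset x]%fset => P].

Definition envD (G D : env) : env :=
  [fsfun y in (finsupp G `|` finsupp D)%fset => G y `+` D y].
Notation "G ⊎ D" := (envD G D) (at level 50, left associativity) : ty_scope.

(* The environment G, x : P for a term under a binder of variable x: x is the
   index 0, and the variables of G are shifted by one. *)
Definition env_cons (P : pos) (G : env) : env :=
  [fsfun y in (0 |` [fset z.+1 | z in finsupp G])%fset =>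
     if y is z.+1 then G z else P].

(* The environment x_1 : P_1, ..., x_k : P_k, for pairwise distinct x_i. *)
Definition env_of (k : nat) (x : k.-tuple nat) (P : k.-tuple pos) : env :=
  [fsfun y in [fset y in tval x]%fset => nth mset0 P (index y x)].

Reserved Notation "G ⊢ t ∶ Q" (at level 70, t at level 69).

Inductive typing : env -> term -> pos -> Prop :=
| ty_ax x P : env1 x P ⊢ Var x ∶ P
| ty_app G G' t u P Q :
    G ⊢ t ∶ [mset P ⊸ Q] -> G' ⊢ u ∶ P -> G ⊎ G' ⊢ App t u ∶ Q
| ty_lam n (G : 'I_n -> env) (P Q : 'I_n -> pos) t :
    (forall i, env_cons (P i) (G i) ⊢ t ∶ Q i) ->
    \big[envD/env0]_(i < n) G i ⊢ Lam t ∶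
      \big[msetD/mset0]_(i < n) [mset P i ⊸ Q i]
where "G ⊢ t ∶ Q" := (typing G t Q) : ty_scope.

Lemma env0E y : env0 y = mset0.
Proof. by rewrite fsfunE. Qed.

Lemma env1E x P y : env1 x P y = if y == x then P else mset0.
Proof. by rewrite fsfunE inE. Qed.

Lemma envDE G D y : (G ⊎ D) y = G y `+` D y.
Proof.
rewrite fsfunE inE; case: ifP => // /negbT; rewrite negb_or => /andP[].
by move=> /fsfun_dflt-> /fsfun_dflt->; rewrite mset0D.
Qed.

Lemma env_consE P G y : env_cons P G y = if y is z.+1 then G z else P.
Proof.
rewrite fsfunE; case: y => [|z]; first by rewrite !inE.
case: ifP => // /negbT; rewrite !inE /= => zG; apply/esym/fsfun_dflt.
by apply: contra zG => zG; apply/imfsetP; exists z.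
Qed.

Lemma env_of_tnth k (x : k.-tuple nat) (P : k.-tuple pos) (i : 'I_k) :
  uniq x -> env_of x P (tnth x i) = tnth P i.
Proof.
move=> ux; rewrite fsfunE inE mem_tnth (tnth_nth 0) (tnth_nth mset0).
by rewrite index_uniq // size_tuple.
Qed.

Lemma env_of_notin k (x : k.-tuple nat) (P : k.-tuple pos) y :
  y \notin x -> env_of x P y = mset0.
Proof. by move=> yx; rewrite fsfunE inE (negPf yx). Qed.

Definition sem (k : nat) (x : k.-tuple nat) (t : term) :
    set (k.-tuple pos * pos) :=
  fun PQ => env_of x PQ.1 ⊢ t ∶ PQ.2.

(* Main.v *)
(* A value is duplicable and erasable for the type system: it has the type
   P + Q in an environment G exactly when G splits as G1 + G2, with the type P
   in G1 and Q in G2, and it has the empty type in the empty environment only.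
   Hence the derivations of t{v/x} : Q are in correspondence with pairs of a
   derivation of t : Q, using x at some type P, and a derivation of v : P, which
   together are a derivation of (fun x => t) v : Q. The sigma rules only
   reassociate a sum of environments. So each root step preserves, in both
   directions, the typings of a term in any environment, and so does each step
   by congruence. *)
From HB Require Import structures.
From mathcomp Require Import all_boot.
From mathcomp Require Import finmap multiset classical_sets.
From Stdlib Require Import Relation_Operators.
Require Import Defs.

Set Implicit Arguments.
Unset Strict Implicit.
Unset Printing Implicit Defensive.

Local Open Scope mset_scope.
Local Open Scope ty_scope.

(** * Algebra of environments *)

Definition env_tl (G : env) : env :=
  [fsfun y in [fset z.-1 | z in finsupp G]%fset => G y.+1].

Lemma env_tlE G y : env_tl G y = G y.+1.
Proof.
rewrite fsfunE; case: ifP => // /negbT yG; apply/esym/fsfun_dflt.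
by apply: contra yG => yG; apply/imfsetP; exists y.+1.
Qed.

Lemma env_cons_tl (G : env) : env_cons (G 0) (env_tl G) = G.
Proof. by apply/fsfunP => -[|y]; rewrite env_consE ?env_tlE. Qed.

Lemma env_cons_inj P P' G G' : env_cons P G = env_cons P' G' -> P = P' /\ G = G'.
Proof.
move=> /fsfunP e; split; first by have := e 0; rewrite !env_consE.
by apply/fsfunP => y; have := e y.+1; rewrite !env_consE.
Qed.

Lemma env_consD P P' G G' :
  env_cons P G ⊎ env_cons P' G' = env_cons (P `+` P') (G ⊎ G').
Proof. by apply/fsfunP => -[|y]; rewrite !(envDE, env_consE). Qed.

Lemma env_cons0 : env_cons mset0 env0 = env0.
Proof. by apply/fsfunP => -[|y]; rewrite !(env0E, env_consE). Qed.

Lemma env1_0 x : env1 x mset0 = env0.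
Proof. by apply/fsfunP => y; rewrite env0E env1E; case: ifP. Qed.

Lemma env1D x P Q : env1 x P ⊎ env1 x Q = env1 x (P `+` Q).
Proof.
by apply/fsfunP => y; rewrite envDE !env1E; case: ifP; rewrite ?mset0D.
Qed.

Lemma env1_S x P : env1 x.+1 P = env_cons mset0 (env1 x P).
Proof. by apply/fsfunP => -[|y]; rewrite env_consE !env1E. Qed.

Lemma env1_0E P : env1 0 P = env_cons P env0.
Proof. by apply/fsfunP => -[|y]; rewrite env_consE env1E ?env0E. Qed.

Lemma envDA : associative envD.
Proof. by move=> F G H; apply/fsfunP => y; rewrite !envDE msetDA. Qed.

Lemma envDC : commutative envD.
Proof. by move=> F G; apply/fsfunP => y; rewrite !envDE msetDC. Qed.

Lemma env0D : left_id env0 envD.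
Proof. by move=> G; apply/fsfunP => y; rewrite envDE env0E mset0D. Qed.

HB.instance Definition _ := Monoid.isComLaw.Build env env0 envD envDA envDC env0D.

Lemma envD0 : right_id env0 envD.
Proof. exact: Monoid.mulm1. Qed.

Lemma envDAC : right_commutative envD.
Proof. exact: Monoid.mulmAC. Qed.

Lemma envDACA : interchange envD envD.
Proof. exact: Monoid.mulmACA. Qed.

(** * Inversion of the typing rules *)

Lemma typing_VarE x G P : G ⊢ Var x ∶ P <-> G = env1 x P.
Proof.
split=> [|->]; last exact: ty_ax.
by move ex: (Var x) => t Gt; case: Gt ex => // ? ? [->].
Qed.

Lemma typing_AppE t u G Q : G ⊢ App t u ∶ Q <->
  exists G1 G2 P, [/\ G = G1 ⊎ G2, G1 ⊢ t ∶ [mset P ⊸ Q] & G2 ⊢ u ∶ P].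
Proof.
split=> [|[G1 [G2 [P [-> tP uP]]]]]; last exact: ty_app tP uP.
move et: (App t u) => s Gs; case: Gs et => // G1 G2 t' u' P {}Q tP uP [-> ->].
by exists G1, G2, P.
Qed.

(** The rule for abstractions with its premises added one at a time, so that arguments about the
    family indexed by ['I_n] become inductions. *)
Inductive lam_typing (t : term) : env -> pos -> Prop :=
| lam_typing0 : lam_typing t env0 mset0
| lam_typingS G P Q G' R : env_cons P G ⊢ t ∶ Q -> lam_typing t G' R ->
    lam_typing t (G ⊎ G') ([mset P ⊸ Q] `+` R).

Lemma typing_LamE t G Q : G ⊢ Lam t ∶ Q <-> lam_typing t G Q.
Proof.
split.
  move et: (Lam t) => s Gs; case: Gs et => // n {}G P {}Q {}s Gs [->].
  elim: n => [|n IHn] in G P Q Gs *; first by rewrite !big_ord0; left.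
  by rewrite !big_ord_recl; right; [apply: Gs|apply: IHn => i; apply: Gs].
elim=> {G Q} [|G P Q G' R GQ _].
  have /= := @ty_lam 0 (fun=> env0) (fun=> mset0) (fun=> mset0) t.
  by rewrite !big_ord0; apply => -[].
move et: (Lam t) => s Gs; case: Gs et => // n D S S' {}s Ds [es].
(* [ext a f] prepends [a] to the family [f]: it is [a] at [ord0] and [f j] at the successor of
   [j]. *)
pose ext T (a : T) (f : 'I_n -> T) i := oapp f a (unlift ord0 i).
have := @ty_lam n.+1 (ext _ G D) (ext _ P S) (ext _ Q S') t.
rewrite !big_ord_recl /ext unlift_none /= -es.
under eq_bigr do rewrite liftK /=.
under [X in _ `+` X]eq_bigr do rewrite !liftK /=.
by apply=> i; case: unliftP => [j|] _ //=; rewrite es.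
Qed.

(** * Splitting multisets and typings of values *)

Lemma msetD_eq0 (T : choiceType) (P Q : {mset T}) :
  P `+` Q = mset0 -> P = mset0 /\ Q = mset0.
Proof.
move=> e; split; apply/msetP => a; have /eqP := congr1 (fun S : {mset T} => S a) e;
  by rewrite msetE2 !mset0E addn_eq0 => /andP[/eqP ? /eqP ?].
Qed.

Lemma mset1D_eq1 (T : choiceType) (a b : T) (R : {mset T}) :
  [mset a] = [mset b] `+` R -> a = b /\ R = mset0.
Proof.
move=> e; have : b \in [mset a] by rewrite e mset1D1.
rewrite in_mset1 => /eqP eb; split=> //; apply: (can_inj (msetDKB [mset b])).
by rewrite -e msetD0 eb.
Qed.

(** The displayed occurrence of [a] can be charged to one of the two summands, then cancelled. This
    decides where a premise of an abstraction goes when its type is split. *)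
Lemma mset1D_split (T : choiceType) (a : T) (R P Q : {mset T}) :
  [mset a] `+` R = P `+` Q ->
  (exists2 P', P = [mset a] `+` P' & R = P' `+` Q) \/
  (exists2 Q', Q = [mset a] `+` Q' & R = P `+` Q').
Proof.
move=> e; have : a \in P `+` Q by rewrite -e mset1D1.
have cancel_a := can_inj (msetDKB [mset a]).
case/msetDP => /msetB1K E; [left; exists (P `\ a)|right; exists (Q `\ a)] => //.
  by apply: cancel_a; rewrite e msetDA E.
by apply: cancel_a; rewrite e msetDCA E.
Qed.

Lemma value_typing0 v G : is_value v -> G ⊢ v ∶ mset0 <-> G = env0.
Proof.
case: v => // [x|t] _; first by rewrite typing_VarE env1_0.
rewrite typing_LamE; split=> [|->]; last by left.
move eN: mset0 => N GN; case: GN eN => // G1 P1 Q1 G2 R _ _ e.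
by have := mset1D1 (P1 ⊸ Q1) R; rewrite -e in_mset0.
Qed.

(** A singleton type leaves room for one premise only: the others would form a derivation of type
    [mset0], whose environment is empty. *)
Lemma typing_Lam1E t G P Q :
  G ⊢ Lam t ∶ [mset P ⊸ Q] <-> env_cons P G ⊢ t ∶ Q.
Proof.
rewrite typing_LamE; split=> [|GQ]; last first.
  rewrite -[G]envD0 -[[mset _]]msetD0.
  by apply: lam_typingS GQ _; left.
move eN: [mset _] => N GN; case: GN eN => [e|G1 P1 Q1 G2 R GQ /typing_LamE GR].
  by have := mset11 (P ⊸ Q); rewrite e in_mset0.
move=> /mset1D_eq1[/lolli_inj[-> ->] R0].
by move: GR; rewrite R0 => /(@value_typing0 (Lam t) _ isT)->; rewrite envD0.
Qed.

(** For a variable, the axiom is additive in its type. For an abstraction, the premises are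
    distributed one by one between [P] and [Q], and put together again for the converse. *)
Lemma value_typingD v G P Q : is_value v -> G ⊢ v ∶ P `+` Q <->
  exists G1 G2, [/\ G = G1 ⊎ G2, G1 ⊢ v ∶ P & G2 ⊢ v ∶ Q].
Proof.
case: v => // [x|t] _.
  rewrite typing_VarE -env1D; split=> [->|[G1 [G2 []]]].
    by exists (env1 x P), (env1 x Q); split=> //; apply: ty_ax.
  by move=> -> /typing_VarE-> /typing_VarE->.
rewrite typing_LamE; split.
  move eN: (P `+` Q) => N GN.
  elim: GN P Q eN => {G N} [|G P1 Q1 G' R GQ _ IH] P Q e.
    by have [-> ->] := msetD_eq0 e; exists env0, env0; rewrite envD0; split=> //;
      apply/value_typing0.
  case/esym/mset1D_split: e => -[S -> eR];
    have [G1 [G2 [-> tP tQ]]] := IH _ _ (esym eR).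
    exists (G ⊎ G1), G2; split=> //; first exact: envDA.
    by apply/typing_LamE; apply: lam_typingS GQ _; apply/typing_LamE.
  exists G1, (G ⊎ G2); split=> //; first exact: Monoid.mulmCA.
  by apply/typing_LamE; apply: lam_typingS GQ _; apply/typing_LamE.
move=> [G1 [G2 [-> /typing_LamE tP /typing_LamE tQ]]].
elim: tP => [|H P1 Q1 H' R HQ _ IH]; first by rewrite env0D mset0D.
by rewrite -msetDA -envDA; right.
Qed.

(** * Typings of substitutions *)

Lemma env_ind (K : env -> Prop) : K env0 ->
  (forall P G, K G -> K (env_cons P G)) -> forall G, K G.
Proof.
move=> K0 KS G.
(* The support is finite, so the induction can run on a strict upper bound of it. *)
have [n Gn] : exists n, forall y, n <= y -> G y = mset0.
  exists (\max_(y <- finsupp G) y).+1 => y ny; apply: fsfun_dflt.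
  by apply: contraL ny => yG; rewrite -leqNgt; apply: leq_bigmax_seq.
elim: n G Gn => [|n IHn] G Gn.
  by have -> : G = env0 by apply/fsfunP => y; rewrite env0E Gn.
by rewrite -(env_cons_tl G); apply/KS/IHn => y ny; rewrite env_tlE Gn.
Qed.

(* [subst_typing s D G]: G is the sum over all variables y of environments of
   derivations of s y : D y, almost all of them empty. *)
Inductive subst_typing : (nat -> term) -> env -> env -> Prop :=
| subst_typing_nil s : subst_typing s env0 env0
| subst_typing_cons s P D G G' : G ⊢ s 0 ∶ P ->
    subst_typing (fun n => s n.+1) D G' ->
    subst_typing s (env_cons P D) (G ⊎ G').

Definition value_subst (s : nat -> term) := forall n, is_value (s n).

(** Both rules can produce [env0], which is also [env_cons mset0 env0]. The second one then adds
    nothing, since a value has type [mset0] in [env0] only. *)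
Lemma subst_typing0E s G : value_subst s ->
  subst_typing s env0 G <-> G = env0.
Proof.
move=> vs; split=> [|->]; last exact: subst_typing_nil.
move eD: {1}env0 => D DG; elim: DG eD vs => {s D G} // s P D G G' sP _ IH.
rewrite -{1}env_cons0 => /env_cons_inj[eP eD] vs.
by rewrite IH ?envD0 //; apply/(value_typing0 _ (vs 0)); rewrite eP.
Qed.

Lemma subst_typing_consE s P D G : value_subst s ->
  subst_typing s (env_cons P D) G <-> exists G1 G2,
    [/\ G = G1 ⊎ G2, G1 ⊢ s 0 ∶ P & subst_typing (fun n => s n.+1) D G2].
Proof.
move=> vs; split=> [|[G1 [G2 [-> sP sD]]]]; last exact: subst_typing_cons.
move eC: (env_cons P D) => C CG; case: CG eC vs => {s C G} [s|s P' D' G G' sP sD].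
  rewrite -{1}env_cons0 => /env_cons_inj[-> ->] vs; exists env0, env0.
  by rewrite envD0; split=> //; [apply/value_typing0|apply: subst_typing_nil].
by move=> /env_cons_inj[-> ->] _; exists G, G'.
Qed.

Lemma subst_typing1E s x P G : value_subst s ->
  subst_typing s (env1 x P) G <-> G ⊢ s x ∶ P.
Proof.
elim: x => [|x IHx] in s G * => vs.
  rewrite env1_0E subst_typing_consE //; split=> [[G1 [G2 []]]|sP].
    by move=> -> sP /subst_typing0E-> //; rewrite envD0.
  by exists G, env0; rewrite envD0; split=> //; apply/subst_typing0E.
rewrite env1_S subst_typing_consE //; split=> [[G1 [G2 []]]|sP].
  by move=> -> /(value_typing0 _ (vs 0))-> /IHx; rewrite env0D; apply.
exists env0, G; rewrite env0D; split=> //; first exact/value_typing0.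
exact/IHx.
Qed.

(** This is [value_typingD] at each variable, followed by an interchange of sums. It lets a
    substitution be shared among the premises of a typing rule. *)
Lemma subst_typingDE s D D' G : value_subst s ->
  subst_typing s (D ⊎ D') G <-> exists G1 G2,
    [/\ G = G1 ⊎ G2, subst_typing s D G1 & subst_typing s D' G2].
Proof.
elim/env_ind: D => [|P D IHD] in s D' G * => vs.
  rewrite env0D; split=> [sD'|[G1 [G2 [-> /subst_typing0E->]]]] //.
    by exists env0, G; rewrite env0D; split=> //; apply/subst_typing0E.
  by rewrite env0D.
have vs' : value_subst (fun n => s n.+1) by [].
rewrite -(env_cons_tl D') env_consD subst_typing_consE //.
split=> [[G1 [G2 []]]|[H1 [H2 []]]] ->.
  move=> /(value_typingD _ _ _ (vs 0))[H1 [H1' [-> sP sP']]].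
  move=> /IHD[] // H2 [H2' [-> sD sD']].
  exists (H1 ⊎ H2), (H1' ⊎ H2'); split; first exact: envDACA.
  - exact: subst_typing_cons.
  - exact: subst_typing_cons.
move=> /subst_typing_consE[] // G1 [G2 [-> sP sD]].
move=> /subst_typing_consE[] // G1' [G2' [-> sP' sD']].
exists (G1 ⊎ G1'), (G2 ⊎ G2'); split; first exact: envDACA.
  by apply/(value_typingD _ _ _ (vs 0)); exists G1, G1'.
by apply/IHD => //; exists G2, G2'.
Qed.

(** * Lifting and the substitution lemma *)

(** A predicate rather than a lemma, because it is first available for variables only; [typing_lift]
    extends it to all terms by means of the substitution lemma for variables. *)
Definition liftable (v : term) := forall (G : env) P,
  G ⊢ lift v ∶ P <-> exists2 G', G = env_cons mset0 G' & G' ⊢ v ∶ P.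

Lemma subst_typing_lift s D G : (forall n, liftable (s n)) ->
  subst_typing (fun n => lift (s n)) D G <->
  exists2 G', G = env_cons mset0 G' & subst_typing s D G'.
Proof.
move=> ls; split=> [|[G' ->]].
  move es': (fun n => _) => s' sD.
  elim: sD s es' ls => {s' D G} [s' s _ _|s' P D G G' sP _ IH s es ls].
    by exists env0; rewrite ?env_cons0 //; apply: subst_typing_nil.
  rewrite -{s'}es in sP IH; have [G1 -> sG1] := (ls 0 _ _).1 sP.
  have [G2 -> sG2] := IH (fun n => s n.+1) erefl (fun n => ls n.+1).
  exists (G1 ⊎ G2); first by rewrite env_consD mset0D.
  exact: subst_typing_cons.
move=> sD; elim: sD ls => {s D G'} [s _|s P D G1 G2 sP _ IH ls].
  by rewrite env_cons0; apply: subst_typing_nil.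
rewrite -[mset0]mset0D -env_consD; apply: subst_typing_cons.
  by apply/ls; exists G1.
by apply: IH => n; apply: ls.
Qed.

(* Applied first to the class of variables, to obtain the typings of a renamed
   term, and then, as lifting is a renaming, to the class of all values. *)
Lemma typing_subst_class (K : term -> Prop) s t G Q :
  (forall v, K v -> is_value v) -> K (Var 0) ->
  (forall v, K v -> K (lift v)) -> (forall v, K v -> liftable v) ->
  (forall n, K (s n)) ->
  G ⊢ subst s t ∶ Q <-> exists2 D, D ⊢ t ∶ Q & subst_typing s D G.
Proof.
move=> K_value K_var0 K_lift K_liftable.
elim: t => [x|t IHt|t IHt u IHu] in s G Q * => Ks /=;
    have vs : value_subst s by move=> n; apply/K_value.
- split=> [sG|[D /typing_VarE->]]; last by move/subst_typing1E; apply.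
  by exists (env1 x Q); [apply: ty_ax|apply/subst_typing1E].
- have Kup n : K (up_subst s n) by case: n => //= n; apply: K_lift.
  have vup : value_subst (up_subst s) by move=> n; apply/K_value.
  (* Only [Var 0] contributes at index 0, as the other components are lifted. Hence the bound
     variable has the same type [P] before and after substitution. *)
  have upE P D G' : subst_typing (up_subst s) D (env_cons P G') <->
      exists2 D', D = env_cons P D' & subst_typing s D' G'.
    have ls n : liftable (s n) by apply: K_liftable.
    split=> [|[D' -> sD']].
      rewrite -(env_cons_tl D) => /subst_typing_consE[] // G1 [G2 [eG]].
      move=> /typing_VarE eG1 /(subst_typing_lift _ _ ls)[H eG2 sH].
      move: eG; rewrite eG1 eG2 env1_0E env_consD msetD0 env0D => /env_cons_inj[-> ->].
      by exists (env_tl D).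
    apply/subst_typing_consE => //; exists (env1 0 P), (env_cons mset0 G').
    rewrite env1_0E env_consD msetD0 env0D; split=> //.
      by rewrite -env1_0E; apply: ty_ax.
    by apply/(subst_typing_lift _ _ ls); exists G'.
  rewrite typing_LamE; split=> [|[D /typing_LamE]].
    elim=> {G Q} [|G P Q G' R].
      by exists env0; [apply/value_typing0|apply/subst_typing0E].
    move=> /IHt[] // _ /[swap] /upE[D1 -> sD1] tD1 _ [D2 tD2 sD2].
    exists (D1 ⊎ D2); last by apply/subst_typingDE => //; exists G, G'.
    by apply/typing_LamE; apply: lam_typingS tD1 _; apply/typing_LamE.
  move=> tD; elim: tD G => {D Q} [|D1 P Q D2 R tD1 _ IH] G.
    by move=> /subst_typing0E-> //; left.
  move=> /subst_typingDE[] // G1 [G2 [-> sD1 sD2]]; right; last exact: IH.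
  by apply/IHt => //; exists (env_cons P D1) => //; apply/upE; exists D1.
rewrite typing_AppE; split=> [[G1 [G2 [P [-> ]]]]|].
  move=> /IHt[] // D1 tD1 sD1 /IHu[] // D2 uD2 sD2.
  exists (D1 ⊎ D2); first exact: ty_app tD1 uD2.
  by apply/subst_typingDE => //; exists G1, G2.
move=> [D /typing_AppE[D1 [D2 [P [-> tD1 uD2]]]]].
move=> /subst_typingDE[] // G1 [G2 [-> sD1 sD2]]; exists G1, G2, P; split=> //.
  by apply/IHt => //; exists D1.
by apply/IHu => //; exists D2.
Qed.

Lemma subst_var f s t : (forall n, s n = Var (f n)) -> subst s t = rename f t.
Proof.
elim: t => [x|t IHt|t IHt u IHu] /= in s f * => sf //.
  by congr Lam; apply: IHt => -[|n] //=; rewrite sf.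
by rewrite (IHt _ f) // (IHu _ f).
Qed.

Definition is_var (t : term) : bool := if t is Var _ then true else false.

Lemma liftable_var v : is_var v -> liftable v.
Proof.
case: v => // x _ G P; rewrite /lift /= typing_VarE env1_S.
by split=> [->|[G' -> /typing_VarE->]] //; exists (env1 x P) => //; apply: ty_ax.
Qed.

Lemma subst_typing_Var D G : subst_typing Var D G <-> G = D.
Proof.
elim/env_ind: D => [|P D IHD] in G *; first exact: subst_typing0E.
have lV n : liftable (Var n) by apply: liftable_var.
rewrite subst_typing_consE //; split=> [[G1 [G2 [-> /typing_VarE->]]]|->].
  move=> /(subst_typing_lift _ _ lV)[G' -> /IHD->].
  by rewrite env1_0E env_consD msetD0 env0D.
exists (env1 0 P), (env_cons mset0 D).
rewrite env1_0E env_consD msetD0 env0D; split=> //.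
  by rewrite -env1_0E; apply: ty_ax.
by apply/(subst_typing_lift _ _ lV); exists D => //; apply/IHD.
Qed.

(** Lifting is the substitution of [Var n.+1] for each [n], whose typings are those of the identity
    substitution shifted by one. *)
Lemma typing_lift t : liftable t.
Proof.
move=> G Q; rewrite /lift -(@subst_var _ (fun n => Var n.+1)) //.
have lV n : liftable (Var n) by apply: liftable_var.
rewrite (@typing_subst_class is_var) //; first last.
- exact: liftable_var.
- by case.
- by case.
split=> [[D tD]|[D -> tD]].
  by move=> /(subst_typing_lift _ _ lV)[G' -> /subst_typing_Var->]; exists D.
by exists D => //; apply/(subst_typing_lift _ _ lV); exists D => //;
  apply/subst_typing_Var.
Qed.

Lemma typing_subst s t G Q : value_subst s ->
  G ⊢ subst s t ∶ Q <-> exists2 D, D ⊢ t ∶ Q & subst_typing s D G.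
Proof.
apply: (@typing_subst_class is_value) => // [|v _]; last exact: typing_lift.
by case.
Qed.

(** * Invariance under the root rules *)

Lemma typing_beta t v G Q : is_value v ->
  G ⊢ App (Lam t) v ∶ Q <-> G ⊢ subst0 v t ∶ Q.
Proof.
move=> vv; have vs : value_subst (fun n => if n is m.+1 then Var m else v) by case.
rewrite typing_AppE /subst0 typing_subst //; split.
  move=> [G1 [G2 [P [-> /typing_Lam1E tP vP]]]]; exists (env_cons P G1) => //.
  rewrite envDC; apply: subst_typing_cons => //; exact/subst_typing_Var.
(* The substitution is [v] at index 0 and the identity above: [D 0] is the type at which [v] is
   used, and the tail of [D] is the environment of the abstraction. *)
move=> [D tD]; rewrite -(env_cons_tl D) => /subst_typing_consE[] // G1 [G2].
move=> [-> vP /subst_typing_Var->]; exists (env_tl D), G1, (D 0).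
by rewrite envDC; split=> //; apply/typing_Lam1E; rewrite env_cons_tl.
Qed.

Lemma typing_sigma1 t u s G Q :
  G ⊢ App (App (Lam t) u) s ∶ Q <-> G ⊢ App (Lam (App t (lift s))) u ∶ Q.
Proof.
split=> /typing_AppE.
  move=> [_ [G3 [R [-> /typing_AppE[G1 [G2 [P [-> /typing_Lam1E tR uP]]]] sR]]]].
  rewrite envDAC; apply: ty_app uP; apply/typing_Lam1E.
  rewrite -[P]msetD0 -env_consD; apply: ty_app tR _.
  by apply/typing_lift; exists G3.
move=> [G1 [G2 [P [-> /typing_Lam1E/typing_AppE[H1 [H2 [R [+ tR sR]]]] uP]]]].
(* The lifted [s] uses nothing at index 0, so the type [P] of the bound variable is exactly [H1 0],
   and [s] can leave the scope of the binder with environment [G3]. *)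
have [G3 -> sG3] := (typing_lift _ _ _).1 sR; rewrite -(env_cons_tl H1) env_consD msetD0.
move=> /env_cons_inj[e ->]; rewrite envDAC; apply: ty_app sG3; apply: ty_app uP.
by apply/typing_Lam1E; rewrite e env_cons_tl.
Qed.

Lemma typing_sigma3 v s u G Q :
  G ⊢ App v (App (Lam s) u) ∶ Q <-> G ⊢ App (Lam (App (lift v) s)) u ∶ Q.
Proof.
split=> /typing_AppE.
  move=> [G3 [_ [R [-> vR /typing_AppE[G1 [G2 [P [-> /typing_Lam1E sR uP]]]]]]]].
  rewrite envDA; apply: ty_app uP; apply/typing_Lam1E.
  rewrite -[P]mset0D -env_consD; apply: ty_app _ sR.
  by apply/typing_lift; exists G3.
move=> [G1 [G2 [P [-> /typing_Lam1E/typing_AppE[H1 [H2 [R [+ vR sR]]]] uP]]]].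
(* Here the lifted term is the function, so the type of the bound variable comes from [H2 0]. *)
have [G3 -> vG3] := (typing_lift _ _ _).1 vR; rewrite -(env_cons_tl H2) env_consD mset0D.
move=> /env_cons_inj[e ->]; rewrite -envDA; apply: ty_app vG3 _; apply: ty_app uP.
by apply/typing_Lam1E; rewrite e env_cons_tl.
Qed.

Lemma typing_root t u G Q : sh_root t u -> G ⊢ t ∶ Q <-> G ⊢ u ∶ Q.
Proof.
case=> [{}t v|{}t {}u s|v s {}u _]; first exact: typing_beta.
  exact: typing_sigma1.
exact: typing_sigma3.
Qed.

(** * Closure under contexts and equivalence *)

(** Environments and types are quantified in the hypothesis because they vary with the position of
    the hole, and from one premise of an abstraction to the next. *)
Lemma typing_fill C r r' : (forall G Q, G ⊢ r ∶ Q <-> G ⊢ r' ∶ Q) ->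
  forall G Q, G ⊢ fill C r ∶ Q <-> G ⊢ fill C r' ∶ Q.
Proof.
move=> rr'; elim: C => [|C IH|C IH u|u C IH] G Q //=.
- rewrite !typing_LamE; split; elim=> {G Q} [|G P Q G' R /IH tQ _ lR];
    by [left|right].
- rewrite !typing_AppE; split=> -[G1 [G2 [P [-> /IH tP uP]]]];
    by exists G1, G2, P.
- rewrite !typing_AppE; split=> -[G1 [G2 [P [-> uP /IH tP]]]];
    by exists G1, G2, P.
Qed.

Lemma typing_sh_equiv t u G Q : sh_equiv t u -> G ⊢ t ∶ Q <-> G ⊢ u ∶ Q.
Proof.
elim=> {t u} [_ _ [C [r [r' [rr' -> ->]]]]|t|t u _ <-|t u v _ -> _ ->] //.
by apply: typing_fill => {}G {}Q; apply: typing_root.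
Qed.

Theorem theorem4p2 (t u : term) (k : nat) (x : k.-tuple nat)
  (x_uniq : uniq x)
  (fv_t : {subset fv t <= x}) (fv_u : {subset fv u <= x}) :
  sh_equiv t u -> sem x t = sem x u.
Proof.
by move=> tu; apply/seteqP; split=> PQ /(typing_sh_equiv _ _ tu).
Qed.
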